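(* Let $\mu_1, \mu_2, \mu_3$ be real numbers with $\mu_1$ irrational, let $0 < \eta < 1/4$, and put $F(x_1,x_2,x_3) = (x_1-\mu_1)^3 + (x_2-\mu_2)^3 + (x_3-\mu_3)^3$. For $N > 0$ let $Z(N)$ denote the set of $\tau \in [0,N]$ for which there is no $\mathbf{x} \in \mathbb{Z}^3$ with $x_i > \mu_i$ ($i=1,2,3$) and $|F(\mathbf{x}) - \tau| < \eta$. Then for all sufficiently large $N$, \[ \mathrm{meas}(Z(N)) > N/2, \] where $\mathrm{meas}$ denotes Lebesgue measure. *)

(* Defs.v *)
From HB Require Import structures.
From mathcomp Require Import all_boot all_order all_algebra.
From mathcomp Require Import all_classical all_reals all_analysis.
Import Order.TTheory GRing.Theory Num.Theory.
Set Implicit Arguments.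
Unset Strict Implicit.
Unset Printing Implicit Defensive.
Local Open Scope classical_set_scope.
Local Open Scope ring_scope.

Definition shifted_cubes (R : realType) (mu1 mu2 mu3 x1 x2 x3 : R) : R :=
  (x1 - mu1) ^+ 3 + (x2 - mu2) ^+ 3 + (x3 - mu3) ^+ 3.

Definition unrepresented (R : realType) (mu1 mu2 mu3 eta N : R) : set R :=
  [set tau | 0 <= tau <= N /\
    ~ exists x1 x2 x3 : int,
        [/\ mu1 < x1%:~R, mu2 < x2%:~R, mu3 < x3%:~R &
            `|shifted_cubes mu1 mu2 mu3 x1%:~R x2%:~R x3%:~R - tau| < eta]].

(* Main.v *)
(** If [0 <= tau <= N] and [|F(x) - tau| < eta], then each [x_i] is one of the
    [n] smallest integers above [mu_i], where [n] is the least natural number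
    with [N + 1 < n ^ 3]. So the represented [tau] are covered by [n ^ 3]
    intervals of length [2 eta < 1/2], and [n ^ 3 = N + O(N ^ (2/3))]. *)
Require Import Defs.
From HB Require Import structures.
From mathcomp Require Import all_boot all_order all_algebra.
From mathcomp Require Import all_classical all_reals all_analysis.
From mathcomp Require Import lra.
Import Order.TTheory GRing.Theory Num.Theory.
Import numFieldNormedType.Exports.
Local Open Scope classical_set_scope.
Local Open Scope ring_scope.

Lemma measurable_ballR (R : realType) (x e : R) :
  measurable (ball x e : set R).
Proof. by apply: measurable_realfun.open_measurable; exact: ball_open. Qed.

Lemma lebesgue_measure_bigsetU_ball (R : realType) (I : Type) (r : seq I)
    (c : I -> R) (e : R) : 0 <= e ->
  (lebesgue_measure (\big[setU/set0]_(i <- r) (ball (c i) e : set R))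
    <= ((e *+ 2) *+ size r)%:E)%E.
Proof.
move=> e0; elim: r => [|i r IH]; first by rewrite big_nil measure0.
rewrite big_cons /= mulrS EFinD.
apply: (le_trans (measureU2 _ _ _)).
- exact: measurable_ballR.
- by apply: bigsetU_measurable => j _; exact: measurable_ballR.
- by apply: leeD => //; move: (lebesgue_measure_ball (c i) e0) => /= ->.
Qed.

(** Removing from [[0, N]] a union of open balls leaves a measurable set: the union is open whatever
    its index set. *)
Lemma measurable_unrepresented (R : realType) (mu1 mu2 mu3 eta N : R) :
  measurable (unrepresented mu1 mu2 mu3 eta N).
Proof.
pose D := [set x : int * int * int |
  [/\ mu1 < x.1.1%:~R, mu2 < x.1.2%:~R & mu3 < x.2%:~R]].
pose U : set R := \bigcup_(x in D)
  ball (shifted_cubes mu1 mu2 mu3 x.1.1%:~R x.1.2%:~R x.2%:~R) eta.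
suff -> : unrepresented mu1 mu2 mu3 eta N = `[0, N]%classic `\` U.
  apply: measurableD => //; apply: measurable_realfun.open_measurable.
  by apply: bigcup_open => x _; exact: ball_open.
apply/seteqP; split=> tau [tauN nrep]; split.
- by rewrite /= in_itv.
- case=> -[[x1 x2] x3] [/= h1 h2 h3] hb; apply: nrep.
  by exists x1, x2, x3.
- by move: tauN; rewrite /= in_itv.
- case=> x1 [x2 [x3 [h1 h2 h3 hb]]]; apply: nrep.
  by exists (x1, x2, x3).
Qed.

(** Here [k] is the rank of [x], counted from 0, among the integers above [mu]. The first of these,
    [floor mu + 1], already exceeds [mu], which makes the bound on [k] strict. *)
Lemma int_gt_floorP (R : realType) (mu : R) (x : int) : mu < x%:~R ->
  exists2 k : nat, x = Num.floor mu + 1 + k%:Z & k%:R < x%:~R - mu.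
Proof.
rewrite -floor_lt_int -lezD1 => hx.
exists `|(x - (Num.floor mu + 1))%R|%N.
  by rewrite gez0_abs ?subr_ge0// addrC subrK.
(* The cast from [nat] is unfolded through [int], so that the absolute value can be removed
   there. *)
rewrite -[X in X < _]/((_%:Z)%:~R) gez0_abs ?subr_ge0//.
rewrite rmorphB /= ltrD2l ltrN2; exact: floorD1_gt.
Qed.

Lemma ltn_of_cube_lt (R : realType) (n k : nat) (y M : R) :
  k%:R < y -> y ^+ 3 < M -> M < n%:R ^+ 3 -> (k < n)%N.
Proof.
move=> ky yM Mn; rewrite -(ltr_nat R); apply: (lt_trans ky).
have y0 : 0 <= y by apply: le_trans (ltW ky).
by rewrite -(@ltr_pXn2r _ 3)// ?nnegrE//; exact: lt_trans Mn.
Qed.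

(** All three cubes are positive, so each one is below their sum, which is less than
    [tau + eta <= N + 1 < n ^ 3]. Hence every rank is below [n]. *)
Lemma itv_subset_unrepresentedU (R : realType) (mu1 mu2 mu3 eta N : R)
    (n : nat) : eta <= 1 -> N + 1 < n%:R ^+ 3 ->
  `[0, N]%classic `<=` unrepresented mu1 mu2 mu3 eta N `|`
    \big[setU/set0]_(k <- enum {: 'I_n * 'I_n * 'I_n})
      ball (shifted_cubes mu1 mu2 mu3
        (Num.floor mu1 + 1 + (k.1.1 : nat)%:Z)%:~R
        (Num.floor mu2 + 1 + (k.1.2 : nat)%:Z)%:~R
        (Num.floor mu3 + 1 + (k.2 : nat)%:Z)%:~R) eta.
Proof.
move=> eta1 Nn tau /=; rewrite in_itv /= => tauN.
case: (pselect (exists x1 x2 x3 : int,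
    [/\ mu1 < x1%:~R, mu2 < x2%:~R, mu3 < x3%:~R &
      `|shifted_cubes mu1 mu2 mu3 x1%:~R x2%:~R x3%:~R - tau| < eta]));
  last by left.
move=> [x1 [x2 [x3 [h1 h2 h3 hb]]]]; right.
have [k1 e1 k1x] := int_gt_floorP _ _ _ h1.
have [k2 e2 k2x] := int_gt_floorP _ _ _ h2.
have [k3 e3 k3x] := int_gt_floorP _ _ _ h3.
have p1 : 0 < (x1%:~R - mu1) ^+ 3 by rewrite exprn_gt0 ?subr_gt0.
have p2 : 0 < (x2%:~R - mu2) ^+ 3 by rewrite exprn_gt0 ?subr_gt0.
have p3 : 0 < (x3%:~R - mu3) ^+ 3 by rewrite exprn_gt0 ?subr_gt0.
have {tauN} [_ tauN] := andP tauN.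
have Fsmall : shifted_cubes mu1 mu2 mu3 x1%:~R x2%:~R x3%:~R < N + 1.
  by move: hb; rewrite ltr_distl => /andP[_ hb]; lra.
rewrite /shifted_cubes in Fsmall.
have l1 : (k1 < n)%N by apply: (ltn_of_cube_lt _ _ _ _ _ k1x _ Nn); lra.
have l2 : (k2 < n)%N by apply: (ltn_of_cube_lt _ _ _ _ _ k2x _ Nn); lra.
have l3 : (k3 < n)%N by apply: (ltn_of_cube_lt _ _ _ _ _ k3x _ Nn); lra.
rewrite -bigcup_seq; exists (Ordinal l1, Ordinal l2, Ordinal l3) => /=.
  by rewrite mem_enum.
by rewrite -e1 -e2 -e3.
Qed.

(** The third hypothesis times [n ^ 2] gives [4 eta n ^ 3 <= n ^ 3 - 3 n ^ 2 = (n - 1) ^ 3 - 3 n + 1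
    <= N + 2 - 3 n], which is less than [N] because [n >= 1]. Halving gives the claim. *)
Lemma cube_bound (R : realFieldType) (eta N n : R) :
  0 < eta -> 1 <= n -> 3 <= n * (1 - 4 * eta) -> (n - 1) ^+ 3 <= N + 1 ->
  N / 2 + (eta *+ 2) * n ^+ 3 < N.
Proof.
move=> eta0 n1 hn hN.
have : n ^+ 2 * 3 <= n ^+ 2 * (n * (1 - 4 * eta)).
  by rewrite ler_wpM2l// sqr_ge0.
by move: hN; rewrite -[eta *+ 2]mulr_natr; lra.
Qed.

Lemma least_cube_gt (R : realType) (M : R) : 1 <= M ->
  exists2 n : nat, M < n%:R ^+ 3 & (n%:R - 1) ^+ 3 <= M.
Proof.
move=> M1; have exn : exists n : nat, M < n%:R ^+ 3.
  exists (Num.truncn M).+1; apply: (lt_le_trans (truncnS_gt M)).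
  by rewrite ler_eXnr// ler1n.
case: (ex_minnP exn) => -[|n] Mn minn.
  (* The least [n] is not 0, since [0 ^ 3 < 1 <= M]; so its predecessor is a natural number, to
     which minimality applies. *)
  by move: Mn; rewrite expr0n /=; lra.
exists n.+1 => //; rewrite -natr1 addrK leNgt; apply/negP => /minn.
by rewrite ltnn.
Qed.

Theorem theorem1p4 (R : realType) (mu1 mu2 mu3 eta : R)
    (hmu1 : irrational mu1) (heta0 : 0 < eta) (heta1 : eta < 1 / 4) :
  exists N0 : R, 0 < N0 /\
    forall N : R, N0 <= N ->
      ((N / 2)%:E < lebesgue_measure (unrepresented mu1 mu2 mu3 eta N))%E.
Proof.
have d0 : 0 < 1 - 4 * eta by lra.
have q0 : 0 < 3 / (1 - 4 * eta) by rewrite divr_gt0.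
(* With this threshold, [n ^ 3 > N + 1] forces [n > 3 / (1 - 4 eta)], as [cube_bound] requires. *)
exists ((3 / (1 - 4 * eta)) ^+ 3); split=> [|N hN]; first by rewrite exprn_gt0.
have N0 : 0 < N by apply: lt_le_trans hN; rewrite exprn_gt0.
have [|n Nn nN] := least_cube_gt R (N + 1); first by lra.
have n1 : 1 <= n%:R :> R.
  by rewrite ler1n lt0n; apply: contraTneq Nn => ->; rewrite expr0n /= -leNgt; lra.
have nd : 3 <= n%:R * (1 - 4 * eta).
  rewrite -ler_pdivrMr// -(@ler_pXn2r _ 3)// ?nnegrE// ?ltW//; lra.
have := cube_bound _ _ _ _ heta0 n1 nd nN.
set Z := unrepresented _ _ _ _ _ => hlt.
have eta1 : eta <= 1 by lra.
have cov := itv_subset_unrepresentedU R mu1 mu2 mu3 eta N n eta1 Nn.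
set V := (X in _ `<=` _ `|` X) in cov.
have mZ : measurable Z by exact: measurable_unrepresented.
have mV : measurable V.
  by apply: bigsetU_measurable => k _; exact: measurable_ballR.
have VE : (lebesgue_measure V <= (eta *+ 2 * n%:R ^+ 3)%:E)%E.
  apply: (le_trans (lebesgue_measure_bigsetU_ball _ _ _ _ _ (ltW heta0))).
  rewrite -cardE !card_prod !card_ord -[_ *+ (_ * _)%N]mulr_natr !natrM.
  by rewrite !exprS expr0 mulr1 -!mulrA.
(* [Z] and [V] cover an interval of length [N], so subadditivity bounds the measure of [Z] from
   below. *)
have NE : (N%:E <= lebesgue_measure Z + lebesgue_measure V)%E.
  apply: (le_trans _ (measureU2 lebesgue_measure mZ mV)).
  have -> : N%:E = lebesgue_measure (`[0, N]%classic : set R).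
    by rewrite lebesgue_measure_itv /= lte_fin N0 -EFinB subr0.
  by apply: le_measure; rewrite ?inE//; exact: measurableU.
have : (N%:E <= lebesgue_measure Z + (eta *+ 2 * n%:R ^+ 3)%:E)%E.
  by apply: (le_trans NE); rewrite leeD2l.
rewrite -leeBlDr// => /(lt_le_trans _); apply.
by rewrite -EFinB lte_fin ltrBrDr.
Qed.
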